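(* Let $(M,\mathrm{dist})$ be a compact metric space endowed with a finite Borel measure $\mu$ such that $\mu(U)>0$ for every nonempty open set $U\subset M$, and let $f\colon M\to M$ be a homeomorphism which is transitive, i.e. there exists $r\in M$ with $\overline{\{f^n(r): n\ge 0\}}=M$. Then exactly one of the following alternatives holds (at least one holds): (i) $f$ has the shadowing property; (ii) $f$ is absolutely not shadowable, i.e. there exists $\varepsilon>0$ such that $p(y_0,d,\varepsilon)=0$ for every $y_0\in M$ and every $d>0$.
   Context: For $a>0$ and $x\in M$, $B(a,x)$ denotes the open ball of radius $a$ centered at $x$. For $d>0$, a sequence $\{y_n\}_{n\ge 0}$ (or finite $\{y_n\}_{n=0}^N$) in $M$ is a $d$-pseudotrajectory if $\mathrm{dist}(y_{n+1},f(y_n))\le d$ for all admissible $n$. It is $\varepsilon$-shadowed if there is $x_0\in M$ with $\mathrm{dist}(y_n,f^n(x_0))\le\varepsilon$ for all admissible $n$. The map $f$ has the shadowing property if for every $\varepsilon>0$ there exists $d>0$ such that every $d$-pseudotrajectory $\{y_n\}_{n\ge0}$ can be $\varepsilon$-shadowed. Random pseudotrajectories: for $y_0\in M$ and $d>0$, let $\Omega(y_0,d)$ be the set of all infinite $d$-pseudotrajectories starting at $y_0$, equipped with the probability measure $P^{y_0,d}$ of the Markov chain starting at $y_0$ with transition law: given $y_n$, the point $y_{n+1}$ is chosen uniformly in $B(d,f(y_n))$ with respect to $\mu$, i.e. $P(y_{n+1}\in A\mid y_n)=\mu(A\cap B(d,f(y_n)))/\mu(B(d,f(y_n)))$ for measurable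 $A\subset M$. For $\varepsilon>0$, $Sh(y_0,d,\varepsilon)\subset\Omega(y_0,d)$ is the (measurable) set of pseudotrajectories that can be $\varepsilon$-shadowed, and $p(y_0,d,\varepsilon)=P^{y_0,d}(Sh(y_0,d,\varepsilon))$. *)

(* Defs.v *)
From HB Require Import structures.
From mathcomp Require Import all_boot all_order all_algebra.
From mathcomp Require Import all_classical all_reals all_analysis.
Set Implicit Arguments. Unset Strict Implicit. Unset Printing Implicit Defensive.
Import Order.TTheory GRing.Theory Num.Theory.
Local Open Scope classical_set_scope.
Local Open Scope ring_scope.

(* Metric spaces with a distinguished point (nonempty).  Nonemptiness is
   implied by the transitivity hypothesis, and is needed by the library to
   build the generated sigma-algebra. *)
#[short(type="pointedMetricType")]
HB.structure Definition PointedMetric (R : numDomainType) :=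
  { M of Metric R M & isPointed M }.

Notation borel M := (g_sigma_algebraType (@open M)).

Definition oball {R : realType} {M : pointedMetricType R} (a : R) (x : M) : set M :=
  [set y | mdist x y < a].

Definition pseudotraj {R : realType} {M : pointedMetricType R} (f : M -> M) (d : R)
  (y : nat -> M) : Prop :=
  forall n, mdist (y n.+1) (f (y n)) <= d.

Definition shadowed {R : realType} {M : pointedMetricType R} (f : M -> M) (eps : R)
  (y : nat -> M) : Prop :=
  exists x0 : M, forall n, mdist (y n) (iter n f x0) <= eps.

Definition shadowing_property {R : realType} {M : pointedMetricType R} (f : M -> M) : Prop :=
  forall eps : R, 0 < eps -> exists2 d : R, 0 < d &
    forall y : nat -> M, pseudotraj f d y -> shadowed f eps y.

Definition cylinders {R : realType} (M : pointedMetricType R) : set (set (nat -> M)) :=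
  [set C | exists n (A : set M), measurable (A : set (borel M)) /\ C = (fun w => w n) @^-1` A].

Arguments cylinders {R} M.

Notation pathspace M := (g_sigma_algebraType (cylinders M)).

(* Transition law: given z, next point uniform in B(d, f z) w.r.t. mu.
   step_int mu f d z A g = \int_{A} g dP(. | z)
                         = mu(B(d,f z))^-1 * \int_{A cap B(d, f z)} g dmu *)
Definition step_int {R : realType} {M : pointedMetricType R}
  (mu : {measure set (borel M) -> \bar R}) (f : M -> M) (d : R) (z : M)
  (A : set M) (g : M -> \bar R) : \bar R :=
  ((fine (mu (oball d (f z))))^-1)%:E *
    \int[mu]_(x in (A `&` oball d (f z) : set (borel M))) g x.

(* iter_int mu f d A m k z = probability that the chain, being at z at time m,
   has its positions at times m+1, ..., m+k in A (m+1), ..., A (m+k). *)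
Fixpoint iter_int {R : realType} {M : pointedMetricType R}
  (mu : {measure set (borel M) -> \bar R}) (f : M -> M) (d : R)
  (A : nat -> set M) (m k : nat) (z : M) {struct k} : \bar R :=
  match k with
  | 0 => 1%E
  | k'.+1 => step_int mu f d z (A m.+1) (iter_int mu f d A m.+1 k')
  end.

(* P is the law P^{y0,d} of the Markov chain started at y0 with the above
   transition law: its finite-dimensional distributions on cylinders are
   P(w 0 in A 0, ..., w n in A n) = 1_{A 0}(y0) * iterated integral. *)
Definition markov_law {R : realType} {M : pointedMetricType R}
  (mu : {measure set (borel M) -> \bar R}) (f : M -> M) (y0 : M) (d : R)
  (P : probability (pathspace M) R) : Prop :=
  forall (n : nat) (A : nat -> set M),
    (forall i, measurable (A i : set (borel M))) ->
    P ([set w : nat -> M | forall i, (i <= n)%N -> A i (w i)] : set (pathspace M)) =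
      ((\1_(A 0%N) y0)%:E * iter_int mu f d A 0 n y0)%E.

Definition Sh {R : realType} {M : pointedMetricType R} (f : M -> M) (y0 : M) (d eps : R)
  : set (nat -> M) :=
  [set y | y 0%N = y0 /\ pseudotraj f d y /\ shadowed f eps y].

Definition absolutely_not_shadowable {R : realType} {M : pointedMetricType R}
  (mu : {measure set (borel M) -> \bar R}) (f : M -> M) : Prop :=
  exists2 eps : R, 0 < eps &
    forall (y0 : M) (d : R), 0 < d ->
      forall P : probability (pathspace M) R, markov_law mu f y0 d P ->
        P (Sh f y0 d eps : set (pathspace M)) = 0%E.

(* Main.v *)
Require Import Defs.
From HB Require Import structures.
From mathcomp Require Import all_boot all_order all_algebra.
From mathcomp Require Import all_classical all_reals all_analysis.
From mathcomp Require Import measurable_realfun lra zify.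
Import Order.TTheory GRing.Theory Num.Theory.
Local Open Scope classical_set_scope.
Local Open Scope ring_scope.

(* The law of the chain is built by the Ionescu-Tulcea construction, through
   the operators averaging a function of the path over its next coordinate.
   Its uniqueness gives the probability of any event depending on finitely many
   coordinates as an iterated average.

   If shadowing fails at scale eps, then for every d compactness yields a finite
   (d/4)-pseudotrajectory y_0, ..., y_N which is not eps-shadowed. Since the
   orbit of some point is dense, y_0 is reached from any point by a
   (d/4)-pseudotrajectory, so the chain passes close to y_0, ..., y_N within a
   bounded time, with probability at least some q > 0 uniform in the present
   state. Hence almost every path contains a block close to y_0, ..., y_N, and
   such a path is not (eps/2)-shadowed.

   Conversely almost every path is a d-pseudotrajectory, so shadowing gives some
   probability 1 to the shadowable paths. *)

(** * Measurability in a separable metric space *)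

Section metric_measurability.
Context {R : realType} {M : pointedMetricType R}.

Definition dense_seq (s : nat -> M) :=
  forall (x : M) (e : R), 0 < e -> exists n, mdist x (s n) < e.

Lemma ex_invS_lt (e : R) : 0 < e -> exists k : nat, k.+1%:R^-1 < e.
Proof.
move=> e0; have [N _ /(_ N (leqnn _))] := near_infty_natSinv_lt (PosNum e0).
by exists N.
Qed.

Lemma nbhs_mdist (x : M) (U : set M) :
  nbhs x U <-> exists2 e : R, 0 < e & forall y, mdist x y < e -> U y.
Proof.
rewrite -metricType_numDomainType.filter_from_mdist_nbhs.
by split=> -[e e0 h]; exists e.
Qed.

Lemma open_oball (c : M) (r : R) : open (oball r c).
Proof.
rewrite openE => x; rewrite /oball/= => cx; apply/nbhs_mdist.
exists (r - mdist c x); first by rewrite subr_gt0.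
move=> y xy /=; apply: le_lt_trans (metric_triangle c x y) _.
by rewrite addrC -ltrBrDr.
Qed.

Lemma measurable_open (U : set M) : open U -> measurable (U : set (borel M)).
Proof. exact: sub_sigma_algebra. Qed.

Lemma measurable_oball (c : M) (r : R) : measurable (oball r c : set (borel M)).
Proof. by apply: measurable_open; exact: open_oball. Qed.

Lemma continuous_measurable (h : M -> M) : continuous h ->
  measurable_fun setT (h : borel M -> borel M).
Proof.
move=> ch; apply: (@measurability _ _ (borel M) (borel M) _ _ (@open M) erefl) => _ [U oU <-].
rewrite setTI; apply: measurable_open.
by move/continuousP: ch; apply.
Qed.

Section joint.
Context (s : nat -> M) (ds : dense_seq s) d (T : measurableType d)
  (phi psi : T -> borel M).
Hypothesis mphi : measurable_fun setT phi.
Hypothesis mpsi : measurable_fun setT psi.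

(** Separability replaces the joint condition by countably many separate ones: some [s n] lies
    within 1/(k+1) of [phi t] and within a - 1/(k+1) of [psi t]. *)
Lemma measurable_mdist_lt (a : R) :
  measurable [set t | mdist (phi t : M) (psi t : M) < a].
Proof.
rewrite (_ : [set _ | _] = \bigcup_n \bigcup_k
   ((phi @^-1` (oball k.+1%:R^-1 (s n))) `&`
    (psi @^-1` (oball (a - k.+1%:R^-1) (s n))))); last first.
  apply/seteqP; split=> t /=.
    (* The detour through [s n] costs at most 2/(k+1), hence half of the available slack. *)
    move=> h; have /ex_invS_lt[k hk] : 0 < (a - mdist (phi t : M) (psi t : M)) / 2.
      by rewrite divr_gt0// subr_gt0.
    have [n hn] := ds (phi t) k.+1%:R^-1 ltac:(by rewrite invr_gt0).
    exists n => //; exists k => //; split; rewrite /oball/= metric_sym//.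
    have := metric_triangle (psi t : M) (phi t) (s n).
    rewrite (metric_sym (psi t : M) (phi t)) => h2.
    by move: k.+1%:R^-1 hk hn => e hk hn; lra.
  move=> [n _ [k _ []]]; rewrite /oball/=; move: k.+1%:R^-1 => e h1 h2.
  have := metric_triangle (phi t : M) (s n) (psi t).
  by rewrite (metric_sym (phi t : M) (s n)) => h3; lra.
apply: bigcupT_measurable => n; apply: bigcupT_measurable => k.
apply: measurableI; rewrite -[X in measurable X]setTI.
  by apply: mphi => //; exact: measurable_oball.
by apply: mpsi => //; exact: measurable_oball.
Qed.

Lemma measurable_mdist_le (a : R) :
  measurable [set t | mdist (phi t : M) (psi t : M) <= a].
Proof.
rewrite (_ : [set _ | _] = \bigcap_k
  [set t | mdist (phi t : M) (psi t : M) < a + k.+1%:R^-1]); last first.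
  apply/seteqP; split=> t /= h.
    by move=> k _ /=; rewrite (le_lt_trans h)// ltrDl invr_gt0.
  rewrite leNgt; apply/negP => h1.
  have /ex_invS_lt[k hk] : 0 < mdist (phi t : M) (psi t : M) - a by rewrite subr_gt0.
  by have /= := h k I; move: k.+1%:R^-1 hk => e hk; lra.
apply: bigcapT_measurable => k; exact: measurable_mdist_lt.
Qed.

End joint.

Definition upd (w : nat -> M) (n : nat) (x : M) : nat -> M :=
  fun i => if i == n then x else w i.

Lemma measurable_coord (i : nat) :
  measurable_fun setT (fun w : pathspace M => (w i : borel M)).
Proof.
move=> _ A mA; rewrite setTI; apply: sub_sigma_algebra.
by exists i, A.
Qed.

Lemma measurable_into_pathspace d (T : measurableType d) (F : T -> pathspace M) :
  (forall i, measurable_fun setT (fun t => (F t i : borel M))) ->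
  measurable_fun setT F.
Proof.
move=> mF; apply: (@measurability _ _ T (pathspace M) _ _ (cylinders M) erefl) => _ [C [i [A [mA ->]]] <-].
exact: mF.
Qed.

Lemma measurable_upd n : measurable_fun setT
  (fun p : pathspace M * borel M => (upd p.1 n p.2 : pathspace M)).
Proof.
apply: measurable_into_pathspace => i; rewrite /upd; case: (i == n).
  exact: measurable_snd.
exact: measurableT_comp (measurable_coord i) measurable_fst.
Qed.

End metric_measurability.

(** * Averaging over the next coordinate *)

Section transition_operator.
Context {R : realType} {M : pointedMetricType R}
  (mu : {finite_measure set (borel M) -> \bar R}) (f : M -> M) (d : R).
Hypothesis d0 : 0 < d.
Hypothesis mu_gt0 : forall U : set M, open U -> U !=set0 ->
  (0 < mu (U : set (borel M)))%E.
Hypothesis cf : continuous f.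
Context {s : nat -> M}.
Hypothesis ds : dense_seq s.

(** For [g] determined up to time m+1 this is its conditional expectation given the path up to time
    m. Resampling one coordinate of a whole path keeps the functions of all times on a single
    space. *)
Definition mean_next (m : nat) (g : pathspace M -> \bar R) (w : pathspace M) : \bar R :=
  (((fine (mu (oball d (f (w m)))))^-1)%:E *
    \int[mu]_(x in (oball d (f (w m)) : set (borel M))) g (upd w m.+1 x))%E.

(** The codomain is left free so that sets, with values in [Prop], and functions are treated
    alike. *)
Definition determined_upto {V : Type} (n : nat) (h : pathspace M -> V) :=
  forall w w' : nat -> M, (forall i, (i <= n)%N -> w i = w' i) -> h w = h w'.

Lemma determined_uptoW {V : Type} m n (h : pathspace M -> V) : (m <= n)%N ->
  determined_upto m h -> determined_upto n h.
Proof. by move=> mn dh w w' e; apply: dh => i im; apply: e; exact: leq_trans mn. Qed.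

Lemma mu_oball_gt0 z : (0 < mu (oball d z : set (borel M)))%E.
Proof.
apply: mu_gt0; first exact: open_oball.
by exists z; rewrite /oball/= mdistxx.
Qed.

Lemma mu_oball_fin z : mu (oball d z : set (borel M)) \is a fin_num.
Proof. by apply: fin_num_measure; exact: measurable_oball. Qed.

Lemma fine_mu_oball_gt0 z : 0 < fine (mu (oball d z : set (borel M))).
Proof. by rewrite -lte_fin fineK ?mu_oball_fin// mu_oball_gt0. Qed.

Lemma measurable_next_section (m : nat) (g : pathspace M -> \bar R) (w : pathspace M)
    (D : set (borel M)) :
  measurable_fun setT g ->
  measurable_fun D (fun x : borel M => g (upd w m.+1 x)).
Proof.
move=> mg; apply: measurable_funTS.
apply: (measurableT_comp (f := g)) => //.
apply: (measurableT_comp (g := fun x => (w, x))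
  (f := fun p : pathspace M * borel M => (upd p.1 m.+1 p.2 : pathspace M))).
  exact: measurable_upd.
exact: measurable_pair1.
Qed.

(** The domain of integration depends on [w]; cutting the integrand off outside the measurable set
    [S] of pairs makes the domain fixed, and Tonelli applies. *)
Lemma measurable_integral_next m (g : pathspace M -> \bar R) :
  measurable_fun setT g -> (forall w, 0 <= g w)%E ->
  measurable_fun setT (fun w : pathspace M =>
    \int[mu]_(x in (oball d (f (w m)) : set (borel M))) g (upd w m.+1 x))%E.
Proof.
move=> mg g0.
pose S := [set p : pathspace M * borel M | mdist (f (p.1 m)) (p.2 : M) < d].
have mS : measurable S.
  apply: (@measurable_mdist_lt R M s ds _ _ (fun p : pathspace M * borel M => f (p.1 m)) snd) => //.
  apply: (measurableT_comp (continuous_measurable _ cf)).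
  exact: measurableT_comp (measurable_coord m) measurable_fst.
pose F := (fun p : pathspace M * borel M => g (upd p.1 m.+1 p.2)) \_ S.
rewrite (_ : (fun _ => _) = fubini_F mu F); last first.
  apply/funext => w; rewrite /fubini_F [LHS]integral_mkcond.
  apply: eq_integral => x _; rewrite /F !patchE.
  by congr (if _ then _ else _).
apply: measurable_fun_fubini_tonelli_F.
  apply/(measurable_restrictT _ mS); apply: measurable_funTS.
  exact: measurableT_comp mg (measurable_upd _).
by move=> p; apply: erestrict_ge0.
Qed.

Lemma mean_next_ge0 m (g : pathspace M -> \bar R) w :
  (forall w, 0 <= g w)%E -> (0 <= mean_next m g w)%E.
Proof.
move=> g0; apply: mule_ge0; last exact: integral_ge0.
by rewrite lee_fin invr_ge0 ltW// fine_mu_oball_gt0.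
Qed.

Lemma measurable_mean_next m (g : pathspace M -> \bar R) :
  measurable_fun setT g -> (forall w, 0 <= g w)%E ->
  measurable_fun setT (mean_next m g).
Proof.
move=> mg g0; apply: emeasurable_funM; last exact: measurable_integral_next.
apply/measurable_EFinP.
(* Balls have positive mass, so the inverse is the power -1, a measurable function. *)
rewrite (_ : (fun _ => _) = (@powR R ^~ (-1)) \o fine \o
    (fun w : pathspace M => mu (oball d (f (w m)) : set (borel M)))); last first.
  by apply/funext => w /=; rewrite powR_inv1// ltW// fine_mu_oball_gt0.
apply: (measurableT_comp (f := @powR R ^~ (-1))); first exact: measurable_powR.
apply: (measurableT_comp (f := @fine R)); first exact: fine_measurable.
(* The mass of the ball is the integral of 1 over it, an instance of the previous measurability
   result. *)
rewrite (_ : (fun _ => _) = (fun w : pathspace M =>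
    \int[mu]_(x in (oball d (f (w m)) : set (borel M))) cst 1 x)%E); last first.
  by apply/funext => w; rewrite integral_cst ?mul1e//; exact: measurable_oball.
exact: (measurable_integral_next m (cst 1%E)).
Qed.

Lemma le_mean_next m (g g' : pathspace M -> \bar R) w :
  measurable_fun setT g -> measurable_fun setT g' ->
  (forall w, 0 <= g w)%E ->
  (forall x, g (upd w m.+1 x) <= g' (upd w m.+1 x))%E ->
  (mean_next m g w <= mean_next m g' w)%E.
Proof.
move=> mg mg' g0 gg'; apply: lee_wpmul2l.
  by rewrite lee_fin invr_ge0 ltW// fine_mu_oball_gt0.
apply: ge0_le_integral => //; [exact: measurable_oball|
  exact: measurable_next_section|exact: measurable_next_section].
Qed.

Lemma eq_mean_next m (g g' : pathspace M -> \bar R) w :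
  (forall x, g (upd w m.+1 x) = g' (upd w m.+1 x))%E ->
  mean_next m g w = mean_next m g' w.
Proof. by move=> gg'; congr (_ * _)%E; apply: eq_integral => x _; exact: gg'. Qed.

Lemma mean_nextD m (g g' : pathspace M -> \bar R) w :
  measurable_fun setT g -> measurable_fun setT g' ->
  (forall w, 0 <= g w)%E -> (forall w, 0 <= g' w)%E ->
  mean_next m (fun w => g w + g' w)%E w = (mean_next m g w + mean_next m g' w)%E.
Proof.
move=> mg mg' g0 g'0; rewrite /mean_next ge0_integralD//; last 3 first.
  exact: measurable_oball.
  exact: measurable_next_section.
  exact: measurable_next_section.
by rewrite ge0_muleDr//; exact: integral_ge0.
Qed.

Lemma mean_next_series m (g : nat -> pathspace M -> \bar R) w :
  (forall k, measurable_fun setT (g k)) -> (forall k w, 0 <= g k w)%E ->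
  mean_next m (fun w => \sum_(k <oo) g k w)%E w = (\sum_(k <oo) mean_next m (g k) w)%E.
Proof.
move=> mg g0; rewrite /mean_next integral_nneseries//; last 2 first.
  exact: measurable_oball.
  by move=> k; exact: measurable_next_section.
by rewrite nneseriesZl// => k _; exact: integral_ge0.
Qed.

(** Taking out what is known: resampling coordinate m+1 leaves [h] unchanged. *)
Lemma mean_next_scale m (h : pathspace M -> R) (g : pathspace M -> \bar R) w :
  determined_upto m h -> (forall w, 0 <= h w) ->
  measurable_fun setT g -> (forall w, 0 <= g w)%E ->
  mean_next m (fun w => (h w)%:E * g w)%E w = ((h w)%:E * mean_next m g w)%E.
Proof.
move=> dh h0 mg g0; rewrite /mean_next.
have hE x : h (upd w m.+1 x) = h w.
  by apply: dh => i im; rewrite /upd ltn_eqF.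
under eq_integral do rewrite hE.
rewrite ge0_integralZl_EFin//; last 2 first.
  exact: measurable_oball.
  exact: measurable_next_section.
by rewrite muleCA.
Qed.

Lemma mean_next1 m w : mean_next m (cst 1%E) w = 1%E.
Proof.
rewrite /mean_next integral_cst ?mul1e; last exact: measurable_oball.
rewrite -[X in (_ * X)%E](fineK (mu_oball_fin _)) -EFinM mulVf//.
by rewrite gt_eqF// fine_mu_oball_gt0.
Qed.

Lemma mean_next_id m (h : pathspace M -> R) w :
  determined_upto m h -> (forall w, 0 <= h w) ->
  mean_next m (fun w => (h w)%:E) w = (h w)%:E.
Proof.
move=> dh h0; rewrite -[RHS]mule1 -(mean_next1 m w) -mean_next_scale//.
by apply: eq_mean_next => x; rewrite mule1.
Qed.

Fixpoint iter_mean (m k : nat) (g : pathspace M -> \bar R) : pathspace M -> \bar R :=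
  if k is k'.+1 then mean_next m (iter_mean m.+1 k' g) else g.

Lemma iter_mean_add m a b (g : pathspace M -> \bar R) :
  iter_mean m (a + b) g = iter_mean m a (iter_mean (m + a) b g).
Proof.
elim: a m => [|a IH] m /=; first by rewrite addn0.
by rewrite IH addnS addSn.
Qed.

Lemma iter_mean_ge0 m k (g : pathspace M -> \bar R) w :
  (forall w, 0 <= g w)%E -> (0 <= iter_mean m k g w)%E.
Proof.
by move=> g0; elim: k m w => [|k IH] m w //=; apply: mean_next_ge0 => w'; exact: IH.
Qed.

Lemma measurable_iter_mean m k (g : pathspace M -> \bar R) :
  measurable_fun setT g -> (forall w, 0 <= g w)%E ->
  measurable_fun setT (iter_mean m k g).
Proof.
move=> mg g0; elim: k m => [|k IH] m //=.
by apply: measurable_mean_next => // w; exact: iter_mean_ge0.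
Qed.

Lemma le_iter_mean m k (g g' : pathspace M -> \bar R) w :
  measurable_fun setT g -> measurable_fun setT g' ->
  (forall w, 0 <= g w)%E -> (forall w, 0 <= g' w)%E -> (forall w, g w <= g' w)%E ->
  (iter_mean m k g w <= iter_mean m k g' w)%E.
Proof.
move=> mg mg' g0 g'0 gg'; elim: k m w => [|k IH] m w //=.
apply: le_mean_next => //; try exact: measurable_iter_mean.
by move=> w'; exact: iter_mean_ge0.
Qed.

Lemma iter_meanD m k (g g' : pathspace M -> \bar R) w :
  measurable_fun setT g -> measurable_fun setT g' ->
  (forall w, 0 <= g w)%E -> (forall w, 0 <= g' w)%E ->
  iter_mean m k (fun w => g w + g' w)%E w = (iter_mean m k g w + iter_mean m k g' w)%E.
Proof.
move=> mg mg' g0 g'0; elim: k m w => [|k IH] m w //=.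
rewrite -mean_nextD; [|exact: measurable_iter_mean|exact: measurable_iter_mean|
  by move=> ?; exact: iter_mean_ge0|by move=> ?; exact: iter_mean_ge0].
by apply: eq_mean_next => x; rewrite IH.
Qed.

Lemma iter_mean_scale m k (h : pathspace M -> R) (g : pathspace M -> \bar R) w :
  determined_upto m h -> (forall w, 0 <= h w) ->
  measurable_fun setT g -> (forall w, 0 <= g w)%E ->
  iter_mean m k (fun w => (h w)%:E * g w)%E w = ((h w)%:E * iter_mean m k g w)%E.
Proof.
move=> dh h0 mg g0; elim: k m dh w => [|k IH] m dh w //=.
rewrite -mean_next_scale//; last 2 first.
  exact: measurable_iter_mean.
  by move=> ?; exact: iter_mean_ge0.
by apply: eq_mean_next => x; rewrite IH//; exact: determined_uptoW dh.
Qed.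

Lemma iter_mean_id m k (h : pathspace M -> R) w :
  determined_upto m h -> (forall w, 0 <= h w) ->
  iter_mean m k (fun w => (h w)%:E) w = (h w)%:E.
Proof.
move=> dh h0; elim: k m dh w => [|k IH] m dh w //=.
rewrite -[RHS](mean_next_id m)//; apply: eq_mean_next => x.
by rewrite IH//; exact: determined_uptoW dh.
Qed.

Lemma determined_iter_mean m k (g : pathspace M -> \bar R) : determined_upto (m + k) g ->
  determined_upto m (iter_mean m k g).
Proof.
elim: k m => [|k IH] m /=; first by rewrite addn0.
rewrite -addSnnS => dg w w' e; rewrite /mean_next e//.
congr (_ * _)%E; apply: eq_integral => x _; apply: (IH _ dg) => i im.
rewrite /upd; case: eqVneq => // im1; apply: e.
by rewrite -ltnS ltn_neqAle im1.
Qed.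

End transition_operator.

(** * The Ionescu-Tulcea construction *)

Section cylinder_algebra.
Context {R : realType} {M : pointedMetricType R}.

(** A second carrier for paths, bearing only the algebra of cylinders, distinct from the
    sigma-algebra of [pathspace M]. *)
Definition cylinder_type : Type := nat -> M.

Definition cylinder_display : Type -> measure_display. Proof. exact. Qed.

Definition cylinder_set (X : set (nat -> M)) :=
  measurable (X : set (pathspace M)) /\ exists n, determined_upto (M := M) n X.

Lemma determined_indic n (X : set (pathspace M)) :
  determined_upto n X -> determined_upto n (\1_X : pathspace M -> R).
Proof.
move=> dX w w' e; rewrite /= !indicE; congr (nat_of_bool _)%:R.
by apply/idP/idP; rewrite !inE (dX _ _ e).
Qed.

Lemma cylinder_set0 : cylinder_set set0.
Proof. by split => //; exists 0%N. Qed.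

Lemma cylinder_setU : setU_closed cylinder_set.
Proof.
move=> A B [mA [a dA]] [mB [b dB]]; split; first exact: measurableU.
exists (maxn a b) => w w' e; rewrite /setU/=.
rewrite -(determined_uptoW _ _ _ (leq_maxl a b) dA _ _ e).
by rewrite -(determined_uptoW _ _ _ (leq_maxr a b) dB _ _ e).
Qed.

Lemma cylinder_setC : setC_closed cylinder_set.
Proof.
move=> A [mA [a dA]]; split; first exact: measurableC.
by exists a => w w' e; rewrite /setC/= (dA _ _ e).
Qed.

HB.instance Definition _ := Pointed.on cylinder_type.
HB.instance Definition _ := @isAlgebraOfSets.Build (cylinder_display M)
  cylinder_type cylinder_set cylinder_set0 cylinder_setU cylinder_setC.

End cylinder_algebra.
Arguments cylinder_type {R} M.

Section ionescu_tulcea.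
Context {R : realType} {M : pointedMetricType R}
  (mu : {finite_measure set (borel M) -> \bar R}) (f : M -> M) (d : R).
Hypothesis d0 : 0 < d.
Hypothesis mu_gt0 : forall U : set M, open U -> U !=set0 ->
  (0 < mu (U : set (borel M)))%E.
Hypothesis cf : continuous f.
Context {s : nat -> M}.
Hypothesis ds : dense_seq s.

Notation iter_mean := (iter_mean mu f d).
Notation ind X := (fun w : pathspace M => (\1_X w)%:E : \bar R).

(* [0] when no such [n] exists. *)
Definition rank (X : set (nat -> M)) : nat :=
  xget 0%N [set n | determined_upto (M := M) n X].

Lemma rankP X : cylinder_set X -> determined_upto (rank X) X.
Proof. by case=> _ /(@xgetPex _ 0%N). Qed.

(* The conditional content of [X] given the coordinates up to [m]. *)
Definition cond (X : set (nat -> M)) (m : nat) : pathspace M -> \bar R :=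
  iter_mean m (rank X - m) (ind X).

Lemma ind_ge0 (X : set (nat -> M)) w : (0 <= ind X w)%E.
Proof. by rewrite lee_fin. Qed.

Lemma measurable_ind (X : set (pathspace M)) : measurable X ->
  measurable_fun setT (ind X).
Proof. by move=> mX; apply/measurable_EFinP; exact: measurable_indic. Qed.

(** From time [n] on the indicator is known, so further averages fix it. Truncated subtraction
    covers the case n < m, where both sides are the indicator itself. *)
Lemma iter_mean_ind_stable (X : set (pathspace M)) m n n' : (n <= n')%N ->
  determined_upto n X -> iter_mean m (n' - m) (ind X) = iter_mean m (n - m) (ind X).
Proof.
move=> nn' dX; have dI := determined_indic _ _ dX.
have id k j : (n <= j)%N -> iter_mean j k (ind X) = ind X.
  move=> nj; apply/funext => w; apply: (@iter_mean_id _ _ _ _ _ d0 mu_gt0) => //.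
  exact: determined_uptoW dI.
have [mn|nm] := leqP m n.
  have -> : (n' - m = (n - m) + (n' - n))%N by lia.
  by rewrite iter_mean_add subnKC// (id _ n).
have -> : (n - m = 0)%N by lia.
by rewrite /= id// ltnW.
Qed.

(** Frees [cond] from the chosen rank: several sets can then be compared at a common horizon. *)
Lemma condE (X : set (pathspace M)) m n : determined_upto n X ->
  cond X m = iter_mean m (n - m) (ind X).
Proof.
move=> dX; have dr : determined_upto (rank X) X.
  by apply: (@xgetPex _ 0%N [set n | determined_upto (M := M) n X]); exists n.
rewrite /cond; have [rn|/ltnW nr] := leqP (rank X) n.
  by rewrite -(@iter_mean_ind_stable _ m _ _ rn).
by rewrite (@iter_mean_ind_stable _ m _ _ nr).
Qed.

Lemma cond_ge0 (X : set (pathspace M)) m w : (0 <= cond X m w)%E.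
Proof. by apply: (@iter_mean_ge0 _ _ _ _ _ d0 mu_gt0) => w'; exact: ind_ge0. Qed.

Lemma measurable_cond (X : set (pathspace M)) m : measurable X ->
  measurable_fun setT (cond X m).
Proof.
move=> mX; apply: (measurable_iter_mean _ _ _ d0 mu_gt0 cf ds); last exact: ind_ge0.
exact: measurable_ind.
Qed.

(** The martingale property of conditional contents. *)
Lemma cond_step (X : set (pathspace M)) m w : cylinder_set X ->
  cond X m w = mean_next mu f d m (cond X m.+1) w.
Proof.
(* A horizon of at least m+1 provides a first averaging step to peel off even when the rank is at
   most m. *)
move=> /rankP dX; rewrite (condE _ m (maxn (rank X) m.+1)).
  rewrite (condE _ m.+1 (maxn (rank X) m.+1)).
    by rewrite (_ : _ - m = (maxn (rank X) m.+1 - m.+1).+1)%N//; lia.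
  by apply: determined_uptoW dX; exact: leq_maxl.
by apply: determined_uptoW dX; exact: leq_maxl.
Qed.

Lemma determined_cond (X : set (pathspace M)) m : cylinder_set X ->
  determined_upto m (cond X m).
Proof.
move=> /rankP dX; apply: determined_iter_mean.
apply: (@determined_uptoW _ _ _ (rank X)); first lia.
by move=> w w' e; congr (_%:E); exact: determined_indic e.
Qed.

Lemma cond_rank (X : set (pathspace M)) m w : cylinder_set X -> (rank X <= m)%N ->
  cond X m w = ind X w.
Proof. by move=> cX rm; rewrite /cond (_ : rank X - m = 0)%N//; lia. Qed.

Definition extend_path (P : nat -> (nat -> M) -> Prop) (m : nat) (w : nat -> M) :
  nat -> M := upd w m.+1 (xget point [set x | P m.+1 (upd w m.+1 x)]).

Fixpoint prefix_path P w0 m : nat -> M :=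
  if m is m'.+1 then extend_path P m' (prefix_path P w0 m') else w0.

(** Dependent choice followed by a diagonal: stage [i] only alters coordinate [i], so the limit path
    agrees up to [m] with the prefix of stage [m], and [P m] sees no more than that. *)
Lemma ex_path (P : nat -> (nat -> M) -> Prop) (w0 : nat -> M) :
  (forall m, determined_upto (M := M) m (P m)) -> P 0%N w0 ->
  (forall m w, P m w -> exists x, P m.+1 (upd w m.+1 x)) ->
  exists w, forall m, P m w.
Proof.
move=> dP P0 Pstep; exists (fun i => prefix_path P w0 i i) => m.
have Pm j : P j (prefix_path P w0 j).
  elim: j => [//|j IH] /=; rewrite /extend_path.
  exact: (@xgetPex _ point [set x | P j.+1 (upd (prefix_path P w0 j) j.+1 x)] (Pstep _ _ IH)).
rewrite -(dP m (prefix_path P w0 m)) => // i.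
elim: m => [|m IH]; first by rewrite leqn0 => /eqP ->.
rewrite leq_eqVlt => /predU1P[-> //|]; rewrite ltnS => im.
by rewrite -IH//= /extend_path /upd ltn_eqF// ltnS.
Qed.

(* Ionescu-Tulcea: if the content of [X] exceeded the sum of the contents of
   the [F k], averaging would allow choosing the coordinates of a path one by
   one while keeping this strict inequality between conditional contents; but
   the path obtained in the limit lies in some [F k]. *)
Lemma cond_sigma_subadditive (X : set (pathspace M)) (F : nat -> set (pathspace M)) w0 :
  cylinder_set X -> (forall k, cylinder_set (F k)) -> X `<=` \bigcup_k F k ->
  (cond X 0 w0 <= \sum_(k <oo) cond (F k) 0 w0)%E.
Proof.
move=> cX cF XF; rewrite leNgt; apply/negP => lt0.
pose P m (w : nat -> M) := (\sum_(k <oo) cond (F k) m w < cond X m w)%E : Prop.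
have [|//|m w Pm|w Pw] := ex_path P w0.
- move=> m w w' e; rewrite /P (determined_cond _ _ cX _ _ e).
  by congr (is_true (_ < _)%E); apply: eq_eseriesr => k _; exact: determined_cond e.
(* If every choice of the next coordinate broke the strict inequality, averaging the reverse
   inequalities would contradict it at time [m]. *)
- apply: contrapT => /forallNP h; move: Pm; rewrite /P ltNge => /negP; apply.
  rewrite cond_step//.
  under eq_eseriesr do rewrite cond_step//.
  rewrite -mean_next_series; last 2 first.
    by move=> k; apply: measurable_cond; case: (cF k).
    by move=> k w'; exact: cond_ge0.
  apply: (@le_mean_next _ _ _ _ _ d0 mu_gt0).
  + by apply: measurable_cond; case: cX.
  + apply: ge0_emeasurable_sum => // [k w' _ _|k _]; first exact: cond_ge0.
    by apply: measurable_cond; case: (cF k).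
  + by move=> ?; exact: cond_ge0.
  + by move=> x; rewrite leNgt; apply/negP/h.
have S0 m : (0 <= \sum_(k <oo) cond (F k) m w)%E.
  by apply: nneseries_ge0 => k _ _; exact: cond_ge0.
have Xw : X w.
  have := Pw (rank X); rewrite /P cond_rank// indicE.
  by have [/set_mem//|_ /lt_geF] := boolP (w \in X); rewrite S0.
have [k _ Fkw] := XF _ Xw.
(* At this time both [X] and [F k] are decided and have content 1, so the sum is already at least
   the content of [X]. *)
have := Pw (maxn (rank X) (rank (F k))).
rewrite /P (@cond_rank X) ?leq_maxl// indicE mem_set// => /lt_geF/negP; apply.
rewrite (nneseriesD1 (n := k))//; last by move=> *; exact: cond_ge0.
rewrite cond_rank ?leq_maxr// indicE mem_set// leeDl//.
by apply: nneseries_ge0 => j _ _; exact: cond_ge0.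
Qed.

Context (y0 : M).

(** Of the constant path only coordinate 0 matters, the later ones being averaged out. *)
Definition chain_content (X : set (cylinder_type M)) : \bar R := cond X 0 (cst y0).

Lemma chain_content_ge0 X : (0 <= chain_content X)%E.
Proof. exact: cond_ge0. Qed.

Lemma cond_set0 m w : cond set0 m w = 0%E.
Proof.
by rewrite (@condE _ m 0)// sub0n /= indicE in_set0.
Qed.

Lemma chain_content_additive : measure_function.semi_additive chain_content.
Proof.
apply/additive2P; first exact: cond_set0.
move=> X Y [mX [a dX]] [mY [b dY]] XY0.
have dX' := determined_uptoW _ _ _ (leq_maxl a b) dX.
have dY' := determined_uptoW _ _ _ (leq_maxr a b) dY.
rewrite /chain_content !(@condE _ 0 (maxn a b))//; last first.
  by move=> w w' e; rewrite /setU/= (dX' _ _ e) (dY' _ _ e).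
rewrite -(iter_meanD _ _ _ d0 mu_gt0 cf ds); last 4 first.
  exact: measurable_ind.
  exact: measurable_ind.
  exact: ind_ge0.
  exact: ind_ge0.
congr (iter_mean _ _ _ _); apply/funext => w.
rewrite !indicE in_setU; case: (boolP (w \in X)) => [|_]; last by rewrite add0e.
move=> /set_mem Xw; case: (boolP (w \in Y)) => [/set_mem Yw|_]; last by rewrite adde0.
by have : (X `&` Y) w by []; rewrite XY0.
Qed.

HB.instance Definition _ := isContent.Build _ _ _ chain_content
  chain_content_ge0 chain_content_additive.

Lemma chain_content_sigma_subadditive :
  measurable_subset_sigma_subadditive chain_content.
Proof. by move=> X F mF mX XF; exact: cond_sigma_subadditive. Qed.

HB.instance Definition _ := Content_SigmaSubAdditive_isMeasure.Build _ _ _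
  chain_content chain_content_sigma_subadditive.

(** The Caratheodory extension lives on the sigma-algebra generated by the cylinder algebra; this
    inclusion transports it to [pathspace M]. *)
Lemma measurable_cylinder_pathspace (X : set (pathspace M)) : measurable X ->
  measurable (X : set (g_sigma_algebraType (@measurable _ (cylinder_type M)))).
Proof.
move=> mX; rewrite -[X in measurable X]setTI.
apply: (@measurable_into_pathspace _ _ _
  (g_sigma_algebraType (@measurable _ (cylinder_type M))) id) => // i _ A mA.
rewrite setTI; apply: sub_sigma_algebra; split.
  by rewrite -[X in measurable X]setTI; exact: measurable_coord.
by exists i => w w' e; rewrite /preimage/= e.
Qed.

Definition chain_measure (X : set (pathspace M)) : \bar R :=
  measure_extension chain_content X.

Lemma chain_measure0 : chain_measure set0 = 0%E.
Proof. exact: measure0. Qed.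

Lemma chain_measure_ge0 X : (0 <= chain_measure X)%E.
Proof. exact: measure_ge0. Qed.

Lemma chain_measure_sigma_additive : semi_sigma_additive chain_measure.
Proof.
move=> F mF tF mUF; apply: measure_semi_sigma_additive => //.
  by move=> i; exact: measurable_cylinder_pathspace.
exact: measurable_cylinder_pathspace.
Qed.

HB.instance Definition _ := isMeasure.Build _ _ _ chain_measure
  chain_measure0 chain_measure_ge0 chain_measure_sigma_additive.

Lemma chain_measureE n (X : set (pathspace M)) : measurable X -> determined_upto n X ->
  chain_measure X = iter_mean 0 n (ind X) (cst y0).
Proof.
move=> mX dX; rewrite /chain_measure/measure_extension/=.
rewrite measurable_mu_extE; last by split; last by exists n.
by rewrite /= /chain_content (@condE _ 0 n)// subn0.
Qed.

Lemma chain_measureT : chain_measure setT = 1%E.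
Proof. by rewrite (@chain_measureE 0)//= indicE in_setT. Qed.

HB.instance Definition _ := Measure_isProbability.Build _ _ _ chain_measure
  chain_measureT.

Lemma ex_chain_probability : exists P : probability (pathspace M) R,
  forall n (X : set (pathspace M)), measurable X -> determined_upto n X ->
    P X = iter_mean 0 n (ind X) (cst y0).
Proof. by exists chain_measure => n X; exact: chain_measureE. Qed.

End ionescu_tulcea.


(** * Uniqueness of the law of the chain *)
Section rectangles.
Context {R : realType} {M : pointedMetricType R}.

Notation ind X := (fun w : pathspace M => (\1_X w)%:E : \bar R).

(** The lower bound [m] lets inductions peel off the first constrained coordinate; for m > n there
    is no constraint. *)
Definition rectangle (m n : nat) (A : nat -> set M) : set (pathspace M) :=
  [set w : nat -> M | forall i, (m <= i <= n)%N -> A i (w i)].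

Lemma measurable_rectangle m n A :
  (forall i, measurable (A i : set (borel M))) -> measurable (rectangle m n A).
Proof.
move=> mA; rewrite (_ : rectangle m n A =
    \bigcap_(i in [set i | (m <= i <= n)%N]) ((fun w : pathspace M => w i) @^-1` A i)).
  apply: bigcap_measurableType => i _; rewrite -[X in measurable X]setTI.
  exact: measurable_coord.
by apply/seteqP; split=> w h i; exact: h.
Qed.

Lemma determined_rectangle m n A : determined_upto n (rectangle m n A).
Proof.
move=> w w' e; apply/propext; split=> h i /[dup] mn /h;
  by case/andP: mn => _ /e ->.
Qed.

Lemma ind_rectangleS m n A w : (m <= n)%N ->
  ind (rectangle m n A) w = ((\1_(A m) (w m))%:E * ind (rectangle m.+1 n A) w)%E.
Proof.
move=> mn; rewrite -EFinM !indicE -natrM mulnb; congr (nat_of_bool _)%:R%:E.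
apply/idP/andP => [/set_mem h|[/set_mem h1 /set_mem h2]]; rewrite ?inE.
  split; first by apply: h; rewrite leqnn.
  by move=> i mi; apply: h; lia.
move=> i; case: (eqVneq i m) => [->//|im mi]; apply: h2; lia.
Qed.

Lemma rectangle_setE n A :
  rectangle 0 n A = [set w : nat -> M | forall i, (i <= n)%N -> A i (w i)].
Proof. by apply/seteqP; split=> w h i; exact: h. Qed.

Definition rectangles : set (set (pathspace M)) :=
  [set X | exists n A, (forall i, measurable (A i : set (borel M))) /\
    X = rectangle 0 n A].

Lemma rectangles_setI : setI_closed rectangles.
Proof.
move=> _ _ [n [A [mA ->]]] [p [B [mB ->]]].
(* Both rectangles are padded with [setT] to a common length. *)
exists (maxn n p), (fun i => (if (i <= n)%N then A i else setT) `&`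
   (if (i <= p)%N then B i else setT)); split.
  by move=> i; apply: measurableI; case: ifP.
apply/seteqP; split=> w /=.
  by move=> [hA hB] i _; split; case: ifPn => // ?; [apply: hA|apply: hB].
move=> h; split=> i /= ip; have [] := h i ltac:(rewrite leq_max; lia).
  by rewrite ip.
by rewrite ip.
Qed.

Lemma measurable_rectangles (X : set (pathspace M)) : measurable X -> <<s rectangles >> X.
Proof.
move: X; apply: smallest_sub; first exact: smallest_sigma_algebra.
move=> _ [i [A [mA ->]]]; apply: sub_sigma_algebra.
exists i, (fun j => if j == i then A else setT); split.
  by move=> j; case: ifP.
apply/seteqP; split=> w /=; first by move=> Aw j _; case: eqP => // ->.
by move=> /(_ i); rewrite eqxx leqnn; apply.
Qed.

End rectangles.

Section markov_law_unique.
Context {R : realType} {M : pointedMetricType R}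
  (mu : {finite_measure set (borel M) -> \bar R}) (f : M -> M) (d : R).
Hypothesis d0 : 0 < d.
Hypothesis mu_gt0 : forall U : set M, open U -> U !=set0 ->
  (0 < mu (U : set (borel M)))%E.
Hypothesis cf : continuous f.
Context {s : nat -> M}.
Hypothesis ds : dense_seq s.

Notation iter_mean := (iter_mean mu f d).
Notation ind X := (fun w : pathspace M => (\1_X w)%:E : \bar R).

(** Matches the recursion on states with the operators on paths: the indicator of [A m.+1] is known
    at time m+1, so it leaves the inner averages and becomes the domain of integration of
    [step_int]. *)
Lemma iter_intE (A : nat -> set M) m k (w : pathspace M) :
  (forall i, measurable (A i : set (borel M))) ->
  iter_int mu f d A m k (w m) = iter_mean m k (ind (rectangle m.+1 (m + k) A)) w.
Proof.
move=> mA; elim: k m w => [|k IH] m w /=.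
  by rewrite indicE mem_set// => i; lia.
rewrite /step_int /mean_next; congr (_ * _)%E.
rewrite integral_mkcondl; apply: eq_integral => x _; rewrite patchE.
have -> : ind (rectangle m.+1 (m + k.+1) A) =
    (fun w => (\1_(A m.+1) (w m.+1))%:E * ind (rectangle m.+2 (m.+1 + k) A) w)%E.
  by apply/funext => w'; rewrite ind_rectangleS addnS// ltnS leq_addr.
rewrite (iter_mean_scale _ _ _ d0 mu_gt0 cf ds); last 4 first.
- by move=> w1 w2 e; rewrite e.
- by move=> w'; rewrite indicE.
- by apply/measurable_EFinP/measurable_indic; exact: measurable_rectangle.
- by move=> w'; rewrite lee_fin.
rewrite -IH /upd eqxx indicE; case: ifPn => _; first by rewrite mul1e.
by rewrite mul0e.
Qed.

Lemma iter_mean_rectangle y0 n A : (forall i, measurable (A i : set (borel M))) ->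
  iter_mean 0 n (ind (rectangle 0 n A)) (cst y0) =
  ((\1_(A 0%N) y0)%:E * iter_int mu f d A 0 n y0)%E.
Proof.
move=> mA; rewrite -[y0 in RHS]/(cst y0 0%N : M) iter_intE//.
rewrite -(iter_mean_scale _ _ _ d0 mu_gt0 cf ds 0 n
  (fun w => \1_(A 0%N) (w 0%N)) _ (cst y0)); last 4 first.
- by move=> w1 w2 e; rewrite e.
- by move=> w'; rewrite indicE.
- by apply/measurable_EFinP/measurable_indic; exact: measurable_rectangle.
- by move=> w'; rewrite lee_fin.
congr (iter_mean _ _ _ _); apply/funext => w.
by rewrite ind_rectangleS.
Qed.

Lemma ex_markov_law y0 : exists2 P : probability (pathspace M) R,
  markov_law mu f y0 d P &
  forall n (X : set (pathspace M)), measurable X -> determined_upto n X ->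
    P X = iter_mean 0 n (ind X) (cst y0).
Proof.
have [P PE] := ex_chain_probability mu f d d0 mu_gt0 cf ds y0.
exists P => // n A mA; rewrite -rectangle_setE (PE n) ?iter_mean_rectangle//.
  exact: measurable_rectangle.
exact: determined_rectangle.
Qed.

(** The law prescribes [P] on rectangles only. These form a pi-system generating the sigma-algebra,
    so [P] coincides with the constructed chain, for which the formula is known. *)
Lemma markov_law_iter_mean y0 (P : probability (pathspace M) R) n (X : set (pathspace M)) :
  markov_law mu f y0 d P -> measurable X -> determined_upto n X ->
  P X = iter_mean 0 n (ind X) (cst y0).
Proof.
move=> lawP mX dX; have [Q lawQ <-//] := ex_markov_law y0.
apply: (@g_sigma_algebra_measure_unique _ _ _ rectangles _ (fun=> setT)) => //.
- by move=> _ [k [A [mA ->]]]; exact: measurable_rectangle.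
- move=> _; exists 0%N, (fun=> setT); split => //.
  by apply/seteqP; split.
- by rewrite bigcup_const.
- exact: rectangles_setI.
- by move=> _ [k [A [mA ->]]]; rewrite rectangle_setE;
  exact: etrans (lawP k A mA) (esym (lawQ k A mA)).
- by move=> k; rewrite /= probability_setT ltry.
- exact: measurable_rectangles.
Qed.

End markov_law_unique.

(** * Compactness and shadowing *)
Section compactness.
Context {R : realType} {M : pointedMetricType R}.
Hypothesis cM : compact [set: M].

Lemma compact_net (e : R) : 0 < e ->
  exists C : seq M, forall x, exists2 c, c \in C & mdist c x < e.
Proof.
move=> e0; move: cM; rewrite compact_cover.
move=> /(_ M setT (fun c => oball e c)) [c _| x _|C _ hC].
- exact: open_oball.
- by exists x => //; rewrite /oball/= mdistxx.
by exists (finmap.enum_fset C) => x; have [c /= Cc cx] := hC x I; exists c.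
Qed.

Lemma compact_dense_seq : exists s : nat -> M, dense_seq s.
Proof.
have h (k : nat) : exists C : seq M, forall x, exists2 c, c \in C & mdist c x < k.+1%:R^-1.
  by apply: compact_net; rewrite invr_gt0.
have [C hC] := choice h.
(* The sequence enumerates the finite 1/(k+1)-nets for all k; codes of no pair get the default
   [point]. *)
exists (fun n => if unpickle n is Some (k, j) then nth point (C k) j else point).
move=> x e /ex_invS_lt[k ke]; have [c cC cx] := hC k x.
exists (pickle (k, index c (C k))); rewrite pickleK nth_index//.
by rewrite metric_sym (lt_trans cx).
Qed.

Lemma compact_cluster_seq (u : nat -> M) : exists x, forall (e : R) N, 0 < e ->
  exists2 n, (N <= n)%N & mdist x (u n) < e.
Proof.
have [x [_ ux]] := cM (u @ \oo) _ filterT.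
exists x => e N e0.
have [||z] := ux [set z | exists2 n, (N <= n)%N & z = u n] (oball e x).
- by exists N => // n /= Nn; exists n.
- by apply/nbhs_mdist; exists e.
by move=> [[n Nn ->] xu]; exists n.
Qed.

End compactness.

(** * Measurability of the set of shadowable paths *)

Section shadowing_measurability.
Context {R : realType} {M : pointedMetricType R}.
Hypothesis cM : compact [set: M].
Variable f : M -> M.
Hypothesis cf : continuous f.

Lemma near_iter (x : M) N (e : R) : 0 < e -> exists2 r, 0 < r &
  forall x', mdist x x' < r -> forall n, (n <= N)%N ->
  mdist (iter n f x) (iter n f x') < e.
Proof.
elim: N e => [|N IH] e e0.
  by exists e => // x' xx' n; rewrite leqn0 => /eqP ->.
have /nbhs_mdist[r1 r10 h1] : nbhs (iter N f x) (f @^-1` oball e (f (iter N f x))).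
  by apply: cf; apply/nbhs_mdist; exists e.
(* Closeness below [r1] at time N gives, by continuity, closeness below [e] at time N+1. *)
have [r r0 hr] := IH (Num.min e r1) ltac:(by rewrite lt_min e0).
exists r => // x' /hr xx' n; rewrite leq_eqVlt => /predU1P[->|].
  by rewrite /=; apply: h1; have := xx' N (leqnn _); rewrite lt_min => /andP[].
by rewrite ltnS => /xx'; rewrite lt_min => /andP[].
Qed.

(** A cluster point of the points shadowing the initial segments shadows the whole sequence; the
    slack 1/(N+1) vanishes along the way. *)
Lemma shadowed_limit (eps : R) (y : nat -> M) :
  (forall N, exists x, forall n, (n <= N)%N ->
    mdist (y n) (iter n f x) <= eps + N.+1%:R^-1) -> shadowed f eps y.
Proof.
move=> /choice[u hu]; have [x hx] := compact_cluster_seq cM u.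
exists x => n; apply/ler_addgt0Pr => e e0.
have e20 : 0 < e / 2 by rewrite divr_gt0.
have [r r0 hr] := near_iter x n _ e20.
have [K hK] := ex_invS_lt _ e20.
have [N] := hx r (maxn n K) r0; rewrite geq_max => /andP[nN KN] /hr/(_ _ (leqnn n)).
have := hu N n nN.
have : N.+1%:R^-1 <= K.+1%:R^-1 :> R by rewrite lef_pV2 ?posrE// ler_nat.
have := metric_triangle (y n) (iter n f (u N)) (iter n f x).
rewrite (metric_sym (iter n f (u N))).
move: N.+1%:R^-1 K.+1%:R^-1 hK => a b; lra.
Qed.

(** Shadowing is expressed with countable quantifiers, whence its measurability. The slack pays for
    moving the shadowing point into the dense sequence. *)
Lemma shadowedE (s : nat -> M) (eps : R) (y : nat -> M) : dense_seq s ->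
  shadowed f eps y <-> forall N, exists j, forall n, (n <= N)%N ->
    mdist (y n) (iter n f (s j)) <= eps + N.+1%:R^-1.
Proof.
move=> ds; split=> [[x hx] N|h]; last first.
  by apply: shadowed_limit => N; have [j hj] := h N; exists (s j).
have e0 : 0 < N.+1%:R^-1 :> R by rewrite invr_gt0.
have [r r0 hr] := near_iter x N _ e0.
have [j /hr hj] := ds x _ r0; exists j => n nN.
have := metric_triangle (y n) (iter n f x) (iter n f (s j)).
have := hx n; have := hj n nN.
move: N.+1%:R^-1 => a; lra.
Qed.

Lemma measurable_pseudotraj (d : R) :
  measurable ([set w | pseudotraj f d w] : set (pathspace M)).
Proof.
have [s ds] := compact_dense_seq cM.
rewrite (_ : [set _ | _] = \bigcap_n [set w : pathspace M | mdist (w n.+1) (f (w n)) <= d]).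
  apply: bigcapT_measurable => n.
  apply: (@measurable_mdist_le R M s ds _ _ (fun w : pathspace M => w n.+1)
    (fun w : pathspace M => f (w n))); first exact: measurable_coord.
  apply: (measurableT_comp (continuous_measurable _ cf)); exact: measurable_coord.
by apply/seteqP; split=> w h n; [move=> _; exact: h|exact: h n I].
Qed.

Lemma measurable_shadowed (eps : R) :
  measurable ([set w | shadowed f eps w] : set (pathspace M)).
Proof.
have [s ds] := compact_dense_seq cM.
rewrite (_ : [set _ | _] = \bigcap_N \bigcup_j \bigcap_(n in [set n | (n <= N)%N])
  [set w : pathspace M | mdist (w n) (iter n f (s j)) <= eps + N.+1%:R^-1]).
  apply: bigcapT_measurable => N; apply: bigcupT_measurable => j.
  apply: bigcap_measurableType => n _.
  apply: (@measurable_mdist_le R M s ds _ _ (fun w : pathspace M => w n)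
    (fun w : pathspace M => iter n f (s j))); first exact: measurable_coord.
  exact: measurable_cst.
apply/seteqP; split=> w /=.
  by move=> /(shadowedE _ _ _ ds) h N _; have [j hj] := h N; exists j.
move=> h; apply/(shadowedE _ _ _ ds) => N.
by have [j _ hj] := h N I; exists j.
Qed.

Lemma Sh_setE (y0 : M) (d eps : R) : Sh f y0 d eps =
  [set w | w 0%N = y0] `&` ([set w | pseudotraj f d w] `&` [set w | shadowed f eps w]).
Proof. by []. Qed.

Lemma measurable_start (y0 : M) : measurable ([set w | w 0%N = y0] : set (pathspace M)).
Proof.
have [s ds] := compact_dense_seq cM.
rewrite (_ : [set _ | _] = [set w : pathspace M | mdist (w 0%N) y0 <= 0]).
  apply: (@measurable_mdist_le R M s ds _ _ (fun w : pathspace M => w 0%N)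
    (fun w : pathspace M => y0)); first exact: measurable_coord.
  exact: measurable_cst.
apply/seteqP; split=> w /= => [->|h]; first by rewrite mdistxx.
by apply: mdist_positivity; apply/eqP; rewrite eq_le h mdist_ge0.
Qed.

Lemma measurable_Sh (y0 : M) (d eps : R) : measurable (Sh f y0 d eps : set (pathspace M)).
Proof.
rewrite Sh_setE; apply: measurableI; first exact: measurable_start.
by apply: measurableI; [exact: measurable_pseudotraj|exact: measurable_shadowed].
Qed.

End shadowing_measurability.

(** * Pseudotrajectories along a dense orbit *)

Section topological_dynamics.
Context {R : realType} {M : pointedMetricType R}.
Hypothesis cM : compact [set: M].
Variables f g : M -> M.
Hypothesis fK : cancel g f.
Hypothesis cf : continuous f.

Lemma compact_unif_continuous (e : R) : 0 < e ->
  exists2 r, 0 < r & forall a b, mdist a b < r -> mdist (f a) (f b) < e.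
Proof.
move=> e0; apply: contrapT => h.
have {}h n : exists ab : M * M, mdist ab.1 ab.2 < n.+1%:R^-1 /\
    e <= mdist (f ab.1) (f ab.2).
  apply: contrapT => /forallNP hn; apply: h; exists n.+1%:R^-1; first by rewrite invr_gt0.
  move=> a b ab; rewrite ltNge; apply/negP => eab.
  by apply: (hn (a, b)).
have [u hu] := choice h.
have [x hx] := compact_cluster_seq cM (fun n => (u n).1).
have e20 : 0 < e / 2 by rewrite divr_gt0.
have [r r0 hr] := near_iter _ cf x 1 _ e20.
have r20 : 0 < r / 2 by rewrite divr_gt0.
have [k hk] := ex_invS_lt _ r20.
have [n kn xn] := hx _ k r20.
have [un fun_] := hu n.
have nk : n.+1%:R^-1 <= k.+1%:R^-1 :> R by rewrite lef_pV2 ?posrE// ler_nat.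
have x1 : mdist x (u n).1 < r by lra.
have x2 : mdist x (u n).2 < r.
  have := metric_triangle x (u n).1 (u n).2.
  move: n.+1%:R^-1 k.+1%:R^-1 un hk nk => a b; lra.
have /= h1 := hr _ x1 1%N (leqnn _); have /= h2 := hr _ x2 1%N (leqnn _).
have := metric_triangle (f (u n).1) (f x) (f (u n).2).
rewrite (metric_sym (f (u n).1) (f x)); lra.
Qed.

(** Contrapositive of [shadowed_limit]; the bound [N] serves all candidate points at once. *)
Lemma not_shadowed_finite (eps : R) (y : nat -> M) : ~ shadowed f eps y ->
  exists N, forall x, exists2 n, (n <= N)%N & eps < mdist (y n) (iter n f x).
Proof.
move=> ny; apply: contrapT => /forallNP h; apply: ny; apply: (shadowed_limit cM _ cf) => N.
have /existsNP[x hx] := h N; exists x => n nN; rewrite leNgt; apply/negP => hn.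
apply: hx; exists n => //; apply: le_lt_trans hn.
by rewrite lerDl invr_ge0.
Qed.

Section chains.
Variable r : M.
Hypothesis dense_r : closure (range (fun n : nat => iter n f r)) = [set: M].

Lemma dense_orbit (z : M) (e : R) : 0 < e -> exists n, mdist z (iter n f r) < e.
Proof.
move=> e0; have : closure (range (fun n : nat => iter n f r)) z by rewrite dense_r.
move=> /(_ (oball e z)) [|_ [[n _ <-] zn]]; last by exists n.
by apply/nbhs_mdist; exists e.
Qed.

(** Density is applied at the preimage of [z] under the [m]-th iterate and pushed forward by
    continuity, which gives late visits even near isolated points. *)
Lemma dense_orbit_tail (z : M) (e : R) m : 0 < e ->
  exists n, mdist z (iter (m + n) f r) < e.
Proof.
move=> e0; have zE : iter m f (iter m g z) = z.
  by elim: m => [//|m IH]; rewrite iterSr /= fK.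
have [d d0 hd] := near_iter _ cf (iter m g z) m _ e0.
have [n /hd/(_ m (leqnn m))] := dense_orbit (iter m g z) _ d0.
by rewrite zE -iterD; exists n.
Qed.

(** The path jumps from [c] onto the dense orbit, follows it until close to y_0, then jumps onto
    [y]. *)
Lemma ex_chain (c : M) (e : R) (y : nat -> M) : 0 < e -> pseudotraj f e y ->
  exists x S, [/\ x 0%N = c, pseudotraj f e x & forall i, x (S.+1 + i)%N = y i].
Proof.
move=> e0 py; have [n hn] := dense_orbit (f c) _ e0.
(* The last orbit point used is f^(n+k)(r), and its image must be close to y_0; hence the shift by
   n+1. *)
have [k hk] := dense_orbit_tail (y 0%N) e n.+1 e0.
exists (fun j => if j is j'.+1 then
    if (j' <= k)%N then iter (n + j') f r else y (j' - k.+1)%N else c), k.+1.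
split=> //= [[|j]|i] /=.
- by rewrite addn0 metric_sym ltW.
- case: (ltngtP j k) => jk.
  + by rewrite addnS /= mdistxx ltW.
  + by rewrite subSS -(subnSK jk); exact: py.
  + by rewrite jk subnn -iterS -addSn ltW.
- by rewrite addSn ltnNge leq_addr/= -addSn addKn.
Qed.

End chains.
End topological_dynamics.

(** * Estimates for the chain *)
Section probability_estimates.
Context {R : realType} {M : pointedMetricType R}
  (mu : {finite_measure set (borel M) -> \bar R}) (f : M -> M) (d : R).
Hypothesis cM : compact [set: M].
Hypothesis d0 : 0 < d.
Hypothesis mu_gt0 : forall U : set M, open U -> U !=set0 ->
  (0 < mu (U : set (borel M)))%E.
Hypothesis cf : continuous f.
Context {s : nat -> M}.
Hypothesis ds : dense_seq s.

Notation iter_mean := (iter_mean mu f d).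
Notation ind X := (fun w : pathspace M => (\1_X w)%:E : \bar R).

(** The complement is a countable union of null events: a wrong start, or a step longer than [d] at
    some time. *)
Lemma markov_law_pseudotraj y0 (P : probability (pathspace M) R) :
  markov_law mu f y0 d P -> P ([set w | w 0%N = y0 /\ pseudotraj f d w]) = 1%E.
Proof.
move=> lawP.
pose S0 : set (pathspace M) := [set w | w 0%N = y0].
pose B n : set (pathspace M) := [set w | mdist (w n.+1) (f (w n)) <= d].
have mB n : measurable (B n).
  apply: (@measurable_mdist_le R M s ds _ _ (fun w : pathspace M => w n.+1)
    (fun w : pathspace M => f (w n))); first exact: measurable_coord.
  apply: (measurableT_comp (continuous_measurable _ cf)); exact: measurable_coord.
have mS0 : measurable S0 by exact: measurable_start.
have PS0 : P (~` S0) = 0%E.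
  rewrite (markov_law_iter_mean _ _ _ d0 mu_gt0 cf ds _ _ 0 _ lawP)//=.
  + by rewrite indicE memNset// => /(_ erefl).
  + exact: measurableC.
  + by move=> w w' e; rewrite /S0 /setC/= e.
have PB n : P (~` B n) = 0%E.
  rewrite (markov_law_iter_mean _ _ _ d0 mu_gt0 cf ds _ _ n.+1 _ lawP)//.
  (* The innermost average already vanishes, since the ball of radius [d] contains no bad next
     point. *)
  + rewrite -addn1 iter_mean_add.
    rewrite (_ : iter_mean (0 + n) 1 _ = fun w => (cst 0%R w)%:E).
      exact: (iter_mean_id _ _ _ d0 mu_gt0).
    apply/funext => w /=; rewrite /mean_next integral0_eq ?mule0// => x.
    rewrite /oball/= => hx; rewrite indicE memNset//; apply.
    by rewrite /B/= /upd eqxx ltn_eqF// metric_sym ltW.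
  + exact: measurableC.
  + by move=> w w' e; rewrite /B /setC/= !e.
have m0 : measurable (~` S0 `|` \bigcup_n ~` B n).
  apply: measurableU; first exact: measurableC.
  by apply: bigcupT_measurable => n; exact: measurableC.
have P0 : P (~` S0 `|` \bigcup_n ~` B n) = 0%E.
  apply/eqP; rewrite eq_le measure_ge0 andbT.
  apply: (@le_trans _ _ (P (~` S0) + P (\bigcup_n ~` B n))%E).
    apply: measureU2; first exact: measurableC.
    by apply: bigcupT_measurable => n; exact: measurableC.
  rewrite PS0 add0e; apply: le_trans (generalized_Boole_inequality _ _ _) _.
  + by move=> n; exact: measurableC.
  + by apply: bigcupT_measurable => n; exact: measurableC.
  + by rewrite eseries0// => n _ _; exact: PB.
rewrite (_ : [set _ | _] = ~` (~` S0 `|` \bigcup_n ~` B n)).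
  by rewrite probability_setC// P0 sube0.
rewrite setCU setCK setC_bigcup; apply/seteqP; split=> w /= [w0 h]; split=> // n.
  by move=> _; rewrite setCK; exact: h.
by have := h n I; rewrite setCK.
Qed.

Lemma ex_pos_lb_seq (T : eqType) (C : seq T) (h : T -> R) : (forall c, 0 < h c) ->
  exists2 q, 0 < q & forall c, c \in C -> q <= h c.
Proof.
move=> h0; elim: C => [|a C [q q0 hq]]; first by exists 1.
exists (Num.min (h a) q); first by rewrite lt_min h0.
by move=> c; rewrite inE ge_min => /predU1P[->|/hq ->]; rewrite ?lexx// orbT.
Qed.

Lemma fine_mu_le (A B : set (borel M)) : measurable A -> measurable B -> A `<=` B ->
  fine (mu A) <= fine (mu B).
Proof.
by move=> mA mB AB; apply: fine_le; rewrite ?fin_num_measure// le_measure ?inE.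
Qed.

Lemma fine_mu_gt0 (A : set M) : open A -> A !=set0 -> 0 < fine (mu (A : set (borel M))).
Proof.
move=> oA A0; rewrite -lte_fin fineK ?mu_gt0// fin_num_measure//.
exact: measurable_open.
Qed.

(** Every ball of radius [r] contains a ball of radius r/2 around a point of a finite net. Dividing
    by the total mass bounds the transition probabilities, whose normalising mass is at most the
    total one. *)
Lemma ex_mu_oball_lb (r : R) : 0 < r -> exists2 q, 0 < q &
  forall z, q <= fine (mu (oball r z : set (borel M))) / fine (mu setT).
Proof.
move=> r0; have r20 : 0 < r / 2 by rewrite divr_gt0.
have [C hC] := compact_net cM _ r20.
have muT : 0 < fine (mu setT) by apply: fine_mu_gt0; [exact: openT|exists point].
have [c|q q0 hq] := ex_pos_lb_seq _ C (fun c => fine (mu (oball (r / 2) c)) / fine (mu setT)).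
  apply: divr_gt0 => //; apply: fine_mu_gt0; first exact: open_oball.
  by exists c; rewrite /oball/= mdistxx.
exists q => // z; have [c cC cz] := hC z; apply: le_trans (hq _ cC) _.
rewrite ler_pM2r ?invr_gt0//; apply: fine_mu_le; [exact: measurable_oball..|].
move=> x; rewrite /oball/= => cx.
by have := metric_triangle z c x; rewrite (metric_sym z c); lra.
Qed.

Lemma mean_next_oball_ge (r q : R) z m w :
  q <= fine (mu (oball r z : set (borel M))) / fine (mu setT) ->
  mdist z (f (w m)) + r <= d ->
  (q%:E <= mean_next mu f d m (fun w' => (\1_(oball r z) (w' m.+1))%:E) w)%E.
Proof.
move=> hq zr; rewrite /mean_next.
under eq_integral do rewrite /upd eqxx.
rewrite integral_indic; [|exact: measurable_oball|exact: measurable_oball].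
rewrite setIidl; last first.
  move=> x; rewrite /oball/= => zx.
  by have := metric_triangle (f (w m)) z x; rewrite (metric_sym _ z); lra.
rewrite -[X in (_ <= _ * X)%E]fineK; last by apply: fin_num_measure; exact: measurable_oball.
rewrite -EFinM lee_fin (le_trans hq)// mulrC ler_wpM2r ?fine_ge0//.
rewrite lef_pV2 ?posrE; last 2 first.
- by apply: fine_mu_gt0; [exact: openT|exists point].
- exact: fine_mu_oball_gt0.
by apply: fine_mu_le => //; exact: measurable_oball.
Qed.

(** Time [t] is left out: the state there is already known when averaging starts. *)
Definition follows (r : R) (x : nat -> M) (t k : nat) : set (pathspace M) :=
  rectangle t.+1 (t + k) (fun i => oball r (x (i - t)%N)).

(** Each step costs a factor [q]: the ball of radius [r] around x_1 lies inside the ball from which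
    the next state is drawn, and from a state in it the induction goes on with the shifted [x]. *)
Lemma iter_mean_follows_ge (r q : R) (x : nat -> M) t k w : 0 < q ->
  (forall z, q <= fine (mu (oball r z : set (borel M))) / fine (mu setT)) ->
  (forall a b, mdist a b < r -> mdist (f a) (f b) <= d / 4) -> r <= d / 4 ->
  pseudotraj f (d / 4) x -> mdist (x 0%N) (w t) < r ->
  ((q ^+ k)%:E <= iter_mean t k (ind (follows r x t k)) w)%E.
Proof.
move=> q0 hq fr rd; elim: k x t w => [|k IH] x t w px xw.
  by rewrite /= indicE mem_set// => i; lia.
have mO i : measurable (oball r (x i) : set (borel M)) by exact: measurable_oball.
have mF y t' k' : measurable (follows r y t' k').
  by apply: measurable_rectangle => i; exact: measurable_oball.
have mI y t' k' : measurable_fun setT (ind (follows r y t' k')).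
  exact/measurable_EFinP/measurable_indic.
rewrite /= exprS mulrC EFinM.
pose O := (fun w' : pathspace M => (\1_(oball r (x 1%N)) (w' t.+1))%:E : \bar R).
have mO' : measurable_fun setT O.
  by apply/measurable_EFinP; apply: measurableT_comp (measurable_coord _);
    exact: measurable_indic.
have qk0 : 0 <= q ^+ k by rewrite exprn_ge0// ltW.
apply: (@le_trans _ _ ((q ^+ k)%:E * mean_next mu f d t O w)%E).
  apply: lee_wpmul2l => //; apply: mean_next_oball_ge => //.
  (* dist(x_1, f(w_t)) + r <= d/4 + d/4 + d/4 *)
  have := px 0%N; have := fr _ _ xw; have := metric_triangle (x 1%N) (f (x 0%N)) (f (w t)).
  move: (mdist (x 1%N) _) (mdist (f _) _) (mdist (x 1%N) _) => a b c h1 h2 h3.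
  by move: d0 rd h1 h2 h3; clear => *; lra.
rewrite -(mean_next_scale mu f d t (fun=> q ^+ k))//; last by move=> w'; rewrite lee_fin.
apply: (le_mean_next _ _ _ d0 mu_gt0).
- by apply: measurable_funeM.
- by apply: (measurable_iter_mean _ _ _ d0 mu_gt0 cf ds) => // w'; rewrite lee_fin.
- by move=> w'; rewrite mule_ge0// lee_fin.
move=> z; set w' := upd w t.+1 z.
have -> : ind (follows r x t k.+1) =
    (fun w => (\1_(oball r (x 1%N)) (w t.+1))%:E *
      ind (follows r (fun j => x j.+1) t.+1 k) w)%E.
  apply/funext => v; rewrite /follows addnS -addSn ind_rectangleS; last first.
    by rewrite addSn ltnS leq_addr.
  rewrite subSnn; congr (_ * (\1__ _)%:E)%E.
  apply/seteqP; split=> u h i hi; have := h i hi;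
    by rewrite (_ : (i - t = (i - t.+1).+1)%N)//; lia.
rewrite (iter_mean_scale _ _ _ d0 mu_gt0 cf ds)//; last by move=> u u' e; rewrite e.
(* Off the ball around x_1 both sides vanish; on it the induction hypothesis applies. *)
rewrite muleC /O [(\1__ (w' _))]indicE.
case: (w' t.+1 \in _) / boolP => [|_]; last by rewrite !mul0e.
rewrite !mul1e => /set_mem; rewrite /oball/= => xz.
by apply: IH => // j; exact: px.
Qed.

End probability_estimates.

(** * Visits to a non-shadowable block *)

Section visits.
Context {R : realType} {M : pointedMetricType R}.

(** The delay [s] may vary up to [L] because the time needed to reach y_0 depends on the present
    state. *)
Definition visits (r : R) (y : nat -> M) (N L t : nat) : set (pathspace M) :=
  [set w : nat -> M | exists2 s, (s <= L)%N &
    forall i, (i <= N)%N -> mdist (y i) (w (t + s + i)%N) < r].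

Lemma measurable_visits r y N L t : measurable (visits r y N L t).
Proof.
rewrite (_ : visits r y N L t = \bigcup_(s in [set s | (s <= L)%N])
   \bigcap_(i in [set i | (i <= N)%N])
   (fun w : pathspace M => w (t + s + i)%N) @^-1` (oball r (y i))).
  apply: bigcup_measurable => s _; apply: bigcap_measurableType => i _.
  rewrite -[X in measurable X]setTI; apply: measurable_coord => //.
  exact: measurable_oball.
apply/seteqP; split=> w /= [s sL h]; exists s => // i iN; exact: h.
Qed.

Lemma determined_visits r y N L t : determined_upto (t + (L + N)) (visits r y N L t).
Proof.
move=> w w' e; apply/propext; split=> -[s sL h]; exists s => // i iN.
  by rewrite -e ?h//; lia.
by rewrite e ?h//; lia.
Qed.

(** If x_0 shadowed the path, its iterate at time t+s would follow the block within r + eps. *)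
Lemma visits_not_shadowed (f : M -> M) (r eps : R) y N L t w :
  (forall x, exists2 n, (n <= N)%N & r + eps < mdist (y n) (iter n f x)) ->
  visits r y N L t w -> ~ shadowed f eps w.
Proof.
move=> ny [s sL hv] [x hx]; have [n nN] := ny (iter (t + s) f x).
have := hv n nN; have := hx (t + s + n)%N.
have := metric_triangle (y n) (w (t + s + n)%N) (iter n f (iter (t + s) f x)).
rewrite -iterD (addnC n).
move: (mdist _ _) (mdist _ _) (mdist _ _) => a b c; lra.
Qed.

(* The windows of length [L + N] starting at the multiples of [L + N] are tested
   one after the other; the [k]-th one only involves times up to [k.+1 * (L + N)]. *)
Definition avoids r (y : nat -> M) N L (k : nat) : set (pathspace M) :=
  [set w | forall j, (j < k)%N -> ~ visits r y N L (j * (L + N)) w].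

Lemma measurable_avoids r y N L k : measurable (avoids r y N L k).
Proof.
rewrite (_ : avoids r y N L k =
    \bigcap_(j in [set j | (j < k)%N]) ~` visits r y N L (j * (L + N))) //.
apply: bigcap_measurableType => j _; apply: measurableC; exact: measurable_visits.
Qed.

Lemma determined_avoids r y N L k : determined_upto (k * (L + N)) (avoids r y N L k).
Proof.
have dv j : (j < k)%N -> determined_upto (k * (L + N)) (visits r y N L (j * (L + N))).
  move=> jk; apply: determined_uptoW (determined_visits _ _ _ _ _).
  by rewrite addnC -mulSn leq_mul2r jk orbT.
move=> w w' e; apply/propext; split=> h j jk;
  by rewrite (dv j jk w w' e, esym (dv j jk w w' e)); exact: h.
Qed.

Lemma avoidsS r y N L k : avoids r y N L k.+1 =
  avoids r y N L k `\` visits r y N L (k * (L + N)).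
Proof.
apply/seteqP; split=> w.
  by move=> h; split=> [j jk|]; apply: h => //; exact: ltnW.
move=> [h hk] j; rewrite ltnS leq_eqVlt => /predU1P[->//|]; exact: h.
Qed.

End visits.

(** * Almost every path visits the block *)

Section absorption.
Context {R : realType} {M : pointedMetricType R}
  (mu : {finite_measure set (borel M) -> \bar R}) (f : M -> M) (d : R).
Hypothesis cM : compact [set: M].
Hypothesis d0 : 0 < d.
Hypothesis mu_gt0 : forall U : set M, open U -> U !=set0 ->
  (0 < mu (U : set (borel M)))%E.
Hypothesis cf : continuous f.
Context {s : nat -> M}.
Hypothesis ds : dense_seq s.

Notation iter_mean := (iter_mean mu f d).
Notation ind X := (fun w : pathspace M => (\1_X w)%:E : \bar R).

(** Whether the first [k] windows were avoided is known when window [k] opens, and from any past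
    that window is visited with probability at least [q]. *)
Lemma avoids_decay (P : probability (pathspace M) R) y0 (q r : R) (y : nat -> M) N L k :
  markov_law mu f y0 d P -> 0 < q ->
  (forall t w, q%:E <= iter_mean t (L + N) (ind (visits r y N L t)) w)%E ->
  fine (P (avoids r y N L k.+1)) <= (1 - q) * fine (P (avoids r y N L k)).
Proof.
move=> lawP q0 hq; set A := avoids r y N L k; set V := visits r y N L (k * (L + N)).
have mA : measurable A by exact: measurable_avoids.
have mV : measurable V by exact: measurable_visits.
have dA : determined_upto (k * (L + N)) A by exact: determined_avoids.
have dV : determined_upto (k * (L + N) + (L + N)) V by exact: determined_visits.
have mI (X : set (pathspace M)) : measurable X -> measurable_fun setT (ind X).
  by move=> mX; apply/measurable_EFinP; exact: measurable_indic.
have I0 (X : set (pathspace M)) w : (0 <= ind X w)%E by rewrite lee_fin.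
have AV : (q%:E * P A <= P (A `&` V))%E.
  rewrite (markov_law_iter_mean _ _ _ d0 mu_gt0 cf ds _ _ _ _ lawP mA dA).
  rewrite (markov_law_iter_mean _ _ _ d0 mu_gt0 cf ds _ _
    (k * (L + N) + (L + N)) _ lawP); last 2 first.
  - exact: measurableI.
  - move=> w w' e; rewrite /setI/= (dV _ _ e) (dA w w')// => i ik.
    by apply: e; exact: leq_trans (leq_addr _ _).
  (* The average is split at the opening of window [k], so that only the inner part has to be
     bounded. *)
  rewrite iter_mean_add -(iter_mean_scale _ _ _ d0 mu_gt0 cf ds _ _ (fun=> q))//; last 2 first.
  - by move=> w; exact: ltW.
  - exact: mI.
  apply: (le_iter_mean _ _ _ d0 mu_gt0 cf ds).
  - by apply: measurable_funeM; exact: mI.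
  - apply: (measurable_iter_mean _ _ _ d0 mu_gt0 cf ds) => //.
    by apply: mI; exact: measurableI.
  - by move=> w; rewrite mule_ge0// lee_fin ltW.
  - by move=> w; exact: (iter_mean_ge0 _ _ _ d0 mu_gt0).
  move=> w; rewrite add0n.
  have -> : ind (A `&` V) = (fun w => (\1_A w)%:E * ind V w)%E.
    by apply/funext => v; rewrite indicI EFinM.
  rewrite (iter_mean_scale _ _ _ d0 mu_gt0 cf ds)//; last 2 first.
  - exact: determined_indic.
  - exact: mI.
  by rewrite muleC; apply: lee_wpmul2l.
have fP (X : set (pathspace M)) : measurable X -> P X \is a fin_num.
  by move=> ?; exact: fin_num_measure.
rewrite avoidsS -/A -/V.
have : P A = (P (A `\` V) + P (A `&` V))%E.
  rewrite -[in LHS](setUIDK A V) measureU//; first by rewrite addeC.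
  - exact: measurableI.
  - exact: measurableD.
  - by rewrite setDE setIACA setICr setI0.
move=> /(congr1 fine); rewrite fineD ?fP//; [|exact: measurableD|exact: measurableI].
have := AV.
rewrite -(fineK (fP _ mA)) -(fineK (fP (A `&` V) (measurableI _ _ mA mV))) lee_fin /=.
by move: (fine _) (fine _) (fine _) => a b c; lra.
Qed.

Lemma avoids_null (P : probability (pathspace M) R) y0 (q r : R) (y : nat -> M) N L
    (X : set (pathspace M)) :
  markov_law mu f y0 d P -> 0 < q ->
  (forall t w, q%:E <= iter_mean t (L + N) (ind (visits r y N L t)) w)%E ->
  measurable X -> (forall k, X `<=` avoids r y N L k) -> P X = 0%E.
Proof.
move=> lawP q0 hq mX XA.
have fP (Y : set (pathspace M)) : measurable Y -> P Y \is a fin_num.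
  by move=> ?; exact: fin_num_measure.
pose p k := fine (P (avoids r y N L k)).
have mA k : measurable (avoids r y N L k) by exact: measurable_avoids.
have Xp k : fine (P X) <= p k.
  by apply: fine_le; rewrite ?fP// le_measure ?inE.
have p0 k : 0 <= p k by exact: fine_ge0.
(* A linear bound suffices: since p_k is at least P(X), each window removes at least q P(X). *)
have pk k : p k + k%:R * (q * fine (P X)) <= p 0%N.
  elim: k => [|k IH]; first by rewrite mul0r addr0.
  have := avoids_decay P y0 q r y N L k lawP q0 hq; rewrite -/(p k) -/(p k.+1) => h.
  have h1 : q * fine (P X) <= q * p k by rewrite ler_pM2l.
  rewrite -natr1 mulrDl mul1r.
  move: IH h h1.
  move: (p k.+1) (p k) (p 0%N) (k%:R * (q * fine (P X)) : R) (q * fine (P X)) => a b c e u; lra.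
have PX0 : 0 <= fine (P X) by exact: fine_ge0.
rewrite -(fineK (fP _ mX)); congr (_%:E); apply/eqP; rewrite eq_le PX0 andbT leNgt.
apply/negP => PXgt0.
have qP : 0 < q * fine (P X) by exact: mulr_gt0.
(* This [k] makes (k+1) q P(X) exceed p_0 + 1; the added 1 keeps the divisor positive. *)
have [k] := ex_invS_lt (q * fine (P X) / (p 0%N + 1)) ltac:(by rewrite divr_gt0// ltr_wpDl).
rewrite ltr_pdivlMr ?ltr_wpDl// ltr_pdivrMl// => hk.
have := pk k.+1; have := p0 k.+1; move: (k.+1%:R * _) hk => b; lra.
Qed.

(** Any state is within [r] of a centre of a finite net, so finitely many chains leading to [y]
    serve all states, and [L] is the largest of their arrival times. *)
Lemma ex_visits_ge (g : M -> M) (z : M) (r : R) (y : nat -> M) N :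
  cancel g f -> closure (range (fun n : nat => iter n f z)) = [set: M] ->
  0 < r -> r <= d / 4 ->
  (forall a b, mdist a b < r -> mdist (f a) (f b) < d / 4) ->
  pseudotraj f (d / 4) y ->
  exists L, exists2 q, 0 < q &
  forall t w, (q%:E <= iter_mean t (L + N) (ind (visits r y N L t)) w)%E.
Proof.
move=> gK zd r0 rd fr py; have d40 : 0 < d / 4 by rewrite divr_gt0.
have [C hC] := compact_net cM _ r0.
have [x hx] := choice (fun c => ex_chain _ _ gK cf _ zd c _ _ d40 py).
have [S hS] := choice hx.
have [q q0 hq] := ex_mu_oball_lb mu cM mu_gt0 r r0.
pose L := \max_(c <- C) (S c).+1; exists L, (q ^+ (L + N)); first exact: exprn_gt0.
move=> t w; have [c cC cw] := hC (w t); have [xc0 px xy] := hS c.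
apply: le_trans (iter_mean_follows_ge mu f d d0 mu_gt0 cf ds r q (x c) t
  (L + N) w q0 hq _ rd px _) _.
- by move=> a b /fr/ltW.
- by rewrite xc0.
have mF : measurable (follows r (x c) t (L + N)).
  by apply: measurable_rectangle => i; exact: measurable_oball.
apply: (le_iter_mean _ _ _ d0 mu_gt0 cf ds).
- exact/measurable_EFinP/measurable_indic.
- by apply/measurable_EFinP/measurable_indic; exact: measurable_visits.
- by move=> v; rewrite lee_fin.
- by move=> v; rewrite lee_fin.
have SL : ((S c).+1 <= L)%N by rewrite /L leq_bigmax_seq.
move=> v; rewrite lee_fin !indicE ler_nat.
case: (v \in follows _ _ _ _) / boolP => // /set_mem fv.
rewrite mem_set//; exists (S c).+1 => // i iN.
(* The chain of centre [c] reads y_i at index S_c + 1 + i, which is at most L + N. *)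
have := fv (t + (S c).+1 + i)%N; rewrite /oball/= -addnA addKn xy; apply; lia.
Qed.

End absorption.

(** * The dichotomy *)
Theorem theorem1 (R : realType) (M : pointedMetricType R)
  (mu : {finite_measure set (borel M) -> \bar R}) (f : M -> M) :
  compact [set: M] ->
  (forall U : set M, open U -> U !=set0 -> (0 < mu (U : set (borel M)))%E) ->
  (exists g : M -> M, [/\ cancel f g, cancel g f, continuous f & continuous g]) ->
  (exists r : M, closure (range (fun n : nat => iter n f r)) = [set: M]) ->
  (shadowing_property f \/ absolutely_not_shadowable mu f) /\
  ~ (shadowing_property f /\ absolutely_not_shadowable mu f).
Proof.
move=> cM mu_gt0 [g [_ gK cf _]] [z zd].
have [s ds] := compact_dense_seq cM.
split.
  have [shf|nshf] := pselect (shadowing_property f); [by left|right].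
  have [eps eps0 heps] : exists2 eps : R, 0 < eps & forall d, 0 < d ->
      exists2 y, pseudotraj f d y & ~ shadowed f eps y.
    apply: contrapT => h; apply: nshf => eps eps0; apply: contrapT => hd; apply: h.
    exists eps => // d d0; apply: contrapT => hy; apply: hd; exists d => // y py.
    by apply: contrapT => ny; apply: hy; exists y.
  have e20 : 0 < eps / 2 by rewrite divr_gt0.
  exists (eps / 2) => // y0 d d0 P lawP.
  have d40 : 0 < d / 4 by rewrite divr_gt0.
  have [y py ny] := heps _ d40.
  have [N hN] := not_shadowed_finite cM f cf eps y ny.
  have [r1 r10 hr1] := compact_unif_continuous cM f cf _ d40.
  (* The three bounds give uniform continuity, room inside the transition ball, and r + eps/2 <= eps
     for [visits_not_shadowed]. *)
  pose r := Num.min r1 (Num.min (d / 4) (eps / 2)).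
  have r0 : 0 < r by rewrite !lt_min r10 d40.
  have rr1 : r <= r1 by rewrite ge_min lexx.
  have rd : r <= d / 4 by rewrite !ge_min lexx orbT.
  have re : r <= eps / 2 by rewrite !ge_min lexx !orbT.
  have [L [q q0 hq]] := ex_visits_ge mu f d cM d0 mu_gt0 cf ds g z r y N gK zd r0 rd
    (fun a b ab => hr1 a b (lt_le_trans ab rr1)) py.
  apply: (avoids_null mu f d d0 mu_gt0 cf ds P y0 q r y N L _ lawP q0 hq).
    exact: measurable_Sh.
  (* A shadowable path avoids every window, so the shadowable paths form a null set. *)
  move=> k w [_ [_ shw]] j _ vw; apply: visits_not_shadowed vw shw => x.
  have [n nN hn] := hN x; exists n => //; apply: le_lt_trans hn.
  by rewrite [leRHS]splitr lerD2r.
move=> [shf [eps eps0 hns]].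
have [d d0 hd] := shf eps eps0.
(* Alternative (ii) speaks of every [P] with the law of the chain; the contradiction needs one to
   exist. *)
have [P lawP _] := ex_markov_law mu f d d0 mu_gt0 cf ds point.
have := markov_law_pseudotraj mu f d cM d0 mu_gt0 cf ds point P lawP.
rewrite (_ : [set w | _] = Sh f point d eps); last first.
  by apply/seteqP; split=> w /= [w0]; [move=> pw; do 2!split => //; exact: hd|case].
by rewrite hns// => /eqP; rewrite eq_sym onee_eq0.
Qed.
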